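(* Let $n\geq 3$ and $k\geq 2$ be integers and let $LCG(n,k)$ be the layer cycle graph with parameters $n,k$. Then the minimum cardinality of a strong resolving set of $LCG(n,k)$ is $sdim(LCG(n,k))=\lceil \tfrac{n}{2}\rceil\, n(n-1)^{k-2}-1$.
   Context: All graphs are simple and connected; $d(u,v)$ is the shortest-path distance. For vertices $u,v$, $I_G[u,v]$ is the set of vertices lying on some shortest $u$–$v$ path. A vertex $w$ strongly resolves $u$ and $v$ if $v\in I_G[u,w]$ or $u\in I_G[v,w]$. A set $R$ of vertices is a strong resolving set of $G$ if every two distinct vertices of $G$ are strongly resolved by some vertex of $R$; $sdim(G)$ is the minimum size of a strong resolving set. The layer cycle graph $LCG(n,k)$ ($n\geq 3$, $k\geq 2$) is constructed as follows. Its vertex set is partitioned into layers $U_1,\dots,U_k$. Layer $U_1$ is a cycle $C_n$ on vertices $1,\dots,n$. For $2\leq p\leq k$, layer $U_p$ consists of $n(n-1)^{p-2}$ vertex-disjoint cycles of length $n$, each with a distinguished vertex called its head vertex. Each vertex of $U_1$ is joined by an edge to the head vertex of exactly one cycle of $U_2$ (distinct vertices to distinct cycles). For $2\leq p<k$, each of the $n-1$ non-head vertices of each cycle of $U_p$ is joined by an edge to the head vertex of exactly one cycle of $U_{p+1}$, in such a way that every cycle of $U_{p+1}$ has its head joined to exactly one such vertex. There are no other edges. Thus $LCG(n,k)$ has $n+\sum_{p=2}^{k}n^2(n-1)^{p-2}$ vertices. *)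

(* Defs.v *)
From mathcomp Require Import all_boot.
Set Implicit Arguments. Unset Strict Implicit. Unset Printing Implicit Defensive.

Section GraphNotions.
Variables (T : finType) (e : rel T).

Definition walk (u v : T) (m : nat) : bool :=
  [exists p : m.-tuple T, path e u p && (last u p == v)].

(* shortest-path distance: least length of a u-v walk (a shortest walk has
   length < #|T| in a connected graph; default #|T| otherwise) *)
Definition dist (u v : T) : nat :=
  \big[minn/#|T|]_(m < #|T| | walk u v m) (m : nat).

Definition in_interval (u v w : T) : bool :=
  dist u w + dist w v == dist u v.

Definition strongly_resolves (w u v : T) : bool :=
  in_interval u w v || in_interval v w u.

Definition strong_resolving_set (R : {set T}) : bool :=
  [forall u, forall v, (u != v) ==> [exists w in R, strongly_resolves w u v]].

Definition is_sdim (N : nat) : Prop :=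
  (exists R : {set T}, strong_resolving_set R /\ #|R| = N) /\
  (forall R : {set T}, strong_resolving_set R -> N <= #|R|).

Definition symmetric_irreflexive : Prop :=
  (forall x y, e x y = e y x) /\ (forall x, ~~ e x x).

End GraphNotions.

(* A vertex of layer p (1 <= p <= k) is a sequence [i0; j1; ...; j_{p-1}] of
   naturals < n:  i0 is the vertex of U_1 = C_n (when p = 1), or the U_1 vertex
   at the root of the branch; the prefix (all but the last entry) identifies the
   cycle containing the vertex, the last entry is the position on that cycle,
   position 0 being the head vertex.  The cycle of layer p+1 with prefix s is
   the one whose head is joined to the vertex s of layer p; hence all inner
   entries (indices 1 .. p-2) must be non-zero (heads have no child cycle). *)

Definition lcg_valid_seq (s : seq nat) : bool :=
  all (fun i => nth 0 s i != 0) (iota 1 (size s).-2).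

Definition LCGraw (n k : nat) : finType := {p : 'I_k & (p.+1).-tuple 'I_n}.

Definition lcg_seq (n k : nat) (v : LCGraw n k) : seq nat :=
  map (@nat_of_ord n) (tagged v).

Definition LCGv (n k : nat) : finType :=
  {v : LCGraw n k | lcg_valid_seq (lcg_seq v)}.

Definition lcg_adj_seq (n : nat) (s1 s2 : seq nat) : bool :=
  (* edge of a cycle (of U_1 or of some U_p) *)
  [&& size s1 == size s2,
      take (size s1).-1 s1 == take (size s2).-1 s2 &
      ((last 0 s1).+1 %% n == last 0 s2) || ((last 0 s2).+1 %% n == last 0 s1)]
  (* edge from a vertex to the head of the cycle attached to it *)
  || (s2 == rcons s1 0) || (s1 == rcons s2 0).

Definition lcg_adj (n k : nat) : rel (LCGv n k) :=
  fun u v => lcg_adj_seq n (lcg_seq (val u)) (lcg_seq (val v)).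

(* Main.v *)
Require Import Defs.
From mathcomp Require Import all_boot.
From mathcomp Require Import zify.
Set Implicit Arguments. Unset Strict Implicit. Unset Printing Implicit Defensive.

(* Write a vertex as its label [i0; j1; ...].  After the longest common prefix of
   two labels is stripped, what remains is [a :: s] and [b :: t] with [a != b] on a
   common cycle, and the distance is the cycle distance of [a] and [b] plus the
   lengths of [s] and [t], each entry [j] costing [1 + d(0, j)].  This is verified
   by checking that the formula drops by at most one along every edge and by exactly
   one along a suitable edge.

   A strong resolving set must meet every pair of mutually maximally distant (MMD)
   vertices, and a set meeting all of them is strong resolving, since every pair of
   vertices extends to an MMD pair along a geodesic.  Every vertex outside the
   non-heads of the cycles of the last layer is a cut vertex, so it is in no MMD
   pair.  Two such non-heads form an MMD pair iff they are at distance [n./2] on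
   their common cycle, or lie on different cycles and are both at distance [n./2]
   from their heads.  Hence all cycles but at most one contain all their far vertices
   (positions [n./2] and [n.+1./2]); pairing up the other positions, such a cycle
   contributes at least [n.+1./2] vertices and the exceptional one at least
   [n.+1./2 - 1].  The bound is attained by the positions [1 .. n.+1./2] of all
   cycles, with one vertex at position [n.+1./2] removed. *)

(** * Walks, distance and mutually maximally distant pairs in an arbitrary finite graph *)

Section Distance.
Variables (T : finType) (e : rel T).
Implicit Types u v w : T.
Local Notation d := (dist e).

Lemma walkP u v m :
  reflect (exists p, [/\ size p = m, path e u p & last u p = v]) (walk e u v m).
Proof.
apply: (iffP existsP) => [[p /andP[ep /eqP lp]]|[p [sp ep lp]]].
  by exists p; rewrite size_tuple.
by move/eqP: sp => sp; exists (Tuple sp); rewrite ep lp eqxx.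
Qed.

Lemma walk_cat u v w m1 m2 :
  walk e u v m1 -> walk e v w m2 -> walk e u w (m1 + m2).
Proof.
move=> /walkP[p [<- ep lp]] /walkP[q [<- eq lq]]; apply/walkP; exists (p ++ q).
by rewrite size_cat cat_path last_cat ep lp.
Qed.

Lemma walk_shorten u v m : walk e u v m -> exists2 m', m' < #|T| & walk e u v m'.
Proof.
move=> /walkP[p [_ ep lp]]; move: lp; case: (shortenP ep) => q eq uq _ lq.
exists (size q); last by apply/walkP; exists q.
by rewrite -[(size q).+1]/(size (u :: q)) -(card_uniqP uq) max_card.
Qed.

Lemma bigmin_leq_mem (I : eqType) (r : seq I) (P : pred I) (F : I -> nat) x0 i :
  i \in r -> P i -> \big[minn/x0]_(j <- r | P j) F j <= F i.
Proof.
elim: r => // j r IH; rewrite inE big_cons => /predU1P[<- ->|ir Pi].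
  exact: geq_minl.
have := IH ir Pi; case: (P j) => // le; exact: leq_trans (geq_minr _ _) le.
Qed.

Lemma dist_le_card u v : d u v <= #|T|.
Proof.
rewrite /dist; elim/big_ind: _ => // [x y lx _|i _]; last exact: ltnW.
exact: leq_trans (geq_minl _ _) lx.
Qed.

Lemma dist_le_walk u v m : walk e u v m -> d u v <= m.
Proof.
move=> w; have [lt|] := ltnP m #|T|; last exact: leq_trans (dist_le_card u v).
have := @bigmin_leq_mem _ (index_enum 'I_#|T|) (fun i => walk e u v i)
  (fun i => i : nat) #|T| (Ordinal lt) (mem_index_enum _) w; exact.
Qed.

Lemma walk_dist u v : d u v = #|T| \/ walk e u v (d u v).
Proof.
rewrite /dist; elim/big_ind: _ => [|x y hx hy|i wi]; [by left | | by right].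
by case: (leqP x y).
Qed.

(** Connectivity is not assumed: a summand equal to the default [#|T|] already bounds every
    distance. *)
Lemma dist_triangle u v w : d u w <= d u v + d v w.
Proof.
have [->|w1] := walk_dist u v; first exact: leq_trans (dist_le_card _ _) (leq_addr _ _).
have [->|w2] := walk_dist v w; first exact: leq_trans (dist_le_card _ _) (leq_addl _ _).
exact/dist_le_walk/(walk_cat w1).
Qed.

Lemma dist_edge u v : e u v -> d u v <= 1.
Proof.
by move=> uv; apply/dist_le_walk/walkP; exists [:: v]; rewrite /= uv.
Qed.

(** The one-step bound puts [f u v] below the length of every walk; following the descents builds a
    walk of length exactly [f u v]. *)
Lemma dist_characterization (f : T -> T -> nat) :
  (forall u, f u u = 0) ->
  (forall u u' v, e u u' -> f u v <= (f u' v).+1) ->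
  (forall u v, u != v -> exists2 u', e u u' & f u v = (f u' v).+1) ->
  d =2 f.
Proof.
move=> f0 f1 fS u v.
have f_walk m : walk e u v m -> f u v <= m.
  move=> /walkP[p [<- ep <-]]; elim: p u ep => [|w p IH] u' /=; first by rewrite f0.
  by case/andP=> /(f1 _ _ (last w p)) + /IH; lia.
have walk_f : walk e u v (f u v).
  move: {f_walk} (f u v) {1 3}u (erefl (f u v)) => m; elim: m {u} => [|m IH] u Em.
    have [<-|/fS[u' _]] := eqVneq u v; last by rewrite Em.
    by apply/walkP; exists [::].
  have [E|/fS[u' uu']] := eqVneq u v; first by rewrite E f0 in Em.
  rewrite Em => -[/esym/IH/walkP[p [<- ep lp]]].
  by apply/walkP; exists (u' :: p); rewrite /= uu'.
apply/eqP; rewrite eqn_leq dist_le_walk //=.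
(* If [dist] had its default value [#|T|], shortening the walk just built would still give one of
   length below [#|T|], which bounds [f u v]. *)
have [->|] := walk_dist u v; last exact: f_walk.
by have [m' /ltnW lt /f_walk] := walk_shorten walk_f => /leq_trans; apply.
Qed.

Lemma distxx u : d u u = 0.
Proof. by apply/eqP; rewrite -leqn0; apply/dist_le_walk/walkP; exists [::]. Qed.

Lemma dist_gt0 u v : u != v -> 0 < d u v.
Proof.
move=> ne; rewrite lt0n; apply: contra ne => /eqP d0.
have [E|] := walk_dist u v.
  by move: (card0_eq (etrans (esym E) d0)) => /(_ u).
by rewrite d0 => /walkP[p [/size0nil-> _ /= ->]].
Qed.

(** One-sided and local at [v]; an MMD pair satisfies it in both orders. *)
Definition maximally_distant u v := forall v', e v v' -> d u v' <= d u v.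

Hypothesis dC : forall u v, d u v = d v u.
Hypothesis d_descent : forall u v, u != v -> exists2 u', e u u' & d u v = (d u' v).+1.

(** If [v] lay strictly inside a geodesic from [u] to [w], its successor there would be a neighbour
    of [v] farther from [u]. *)
Lemma mmd_resolver u v w :
  maximally_distant u v -> maximally_distant v u ->
  strongly_resolves e w u v -> w = u \/ w = v.
Proof.
have half u0 v0 : maximally_distant u0 v0 -> in_interval e u0 w v0 -> w = v0.
  move=> mm; have [->//|/d_descent[v' /mm le E]] := eqVneq v0 w.
  rewrite /in_interval E => /eqP; have := dist_triangle u0 v' w; lia.
by move=> m1 m2 /orP[/half|/half]; auto.
Qed.

(** Among the pairs joined by a geodesic through [u] and then [v], take one at maximal distance: a
    farther neighbour of either end would give a longer such geodesic. *)
Lemma mmd_extension u v :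
  exists u' v', [/\ d u' u + d u v + d v v' = d u' v',
                    maximally_distant u' v' & maximally_distant v' u'].
Proof.
pose P (p : T * T) := d p.1 u + d u v + d v p.2 == d p.1 p.2.
have P0 : P (u, v) by rewrite /P /= !distxx addn0.
have [[u' v'] /eqP /= Pp max] := @arg_maxnP _ (u, v) P (fun p => d p.1 p.2) P0.
exists u', v'; split=> //= z ez; rewrite leqNgt; apply/negP => lt;
  have ed := dist_edge ez.
  suff /max /= : P (u', z) by rewrite leqNgt lt.
  apply/eqP => /=.
  have := dist_triangle u' u z; have := dist_triangle u v z.
  have := dist_triangle v v' z; have := dist_triangle u' v' z; lia.
suff /max /= : P (z, v') by rewrite leqNgt dC (dC z) lt.
apply/eqP => /=.
have := dist_triangle z u v'; have := dist_triangle u v v'.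
have := dist_triangle z u' u; have := dist_triangle z u' v'.
move: lt ed; rewrite (dC v' z) (dC u' z) (dC v' u'); lia.
Qed.

Lemma strong_resolving_of_mmd (R : {set T}) :
  (forall u v, u != v -> maximally_distant u v -> maximally_distant v u ->
     (u \in R) || (v \in R)) ->
  strong_resolving_set e R.
Proof.
move=> cov; apply/forallP=> u; apply/forallP=> v; apply/implyP=> ne.
have [u' [v' [E m1 m2]]] := mmd_extension u v.
have ne' : u' != v'.
  apply/eqP=> E'; move: E (dist_gt0 ne); rewrite E'.
  rewrite distxx; lia.
have := dist_triangle u' u v'; have := dist_triangle u v v'.
have := dist_triangle u' v v'; have := dist_triangle u' u v => t1 t2 t3 t4.
case/orP: (cov _ _ ne' m1 m2) => inR; apply/existsP; [exists u'|exists v'];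
  rewrite inR /= /strongly_resolves /in_interval; apply/orP; [right|left]; apply/eqP.
  by rewrite (dC v u) (dC u u') (dC v u'); lia.
lia.
Qed.

End Distance.

(** * Distance on a single cycle *)

Section CycleDistance.
Variable n : nat.

(** With truncated subtraction, [(i - j) + (j - i)] is the absolute difference. *)
Definition cyc (i j : nat) := minn ((i - j) + (j - i)) (n - ((i - j) + (j - i))).

Definition cadj (a b : nat) := (a.+1 %% n == b) || (b.+1 %% n == a).

Lemma cadjE a b : a < n -> b < n ->
  cadj a b = [|| b == a.+1, a == b.+1, (a.+1 == n) && (b == 0) | (b.+1 == n) && (a == 0)].
Proof.
have modSE x y : x < n -> (x.+1 %% n == y) = (y == if x.+1 == n then 0 else x.+1).
  move=> xn; have [->|ne] := eqVneq x.+1 n; first by rewrite modnn eq_sym.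
  by rewrite modn_small 1?eq_sym //; lia.
move=> an bn; rewrite /cadj !modSE //.
by case: (eqVneq a.+1 n); case: (eqVneq b.+1 n); lia.
Qed.

Lemma cycC i j : cyc i j = cyc j i. Proof. rewrite /cyc; lia. Qed.
Lemma cycii i : cyc i i = 0. Proof. rewrite /cyc; lia. Qed.
Lemma cyc0 : cyc 0 0 = 0. Proof. exact: cycii. Qed.

Lemma cyc_le_half i j : cyc i j <= n./2. Proof. rewrite /cyc; lia. Qed.

Lemma cyc_lip a b j : a < n -> b < n -> j < n -> cadj a b -> cyc a j <= (cyc b j).+1.
Proof. by move=> an bn jn; rewrite cadjE // /cyc; lia. Qed.

Lemma cyc_descent a j : a < n -> j < n -> a != j ->
  exists b, [/\ b < n, cadj a b & cyc a j = (cyc b j).+1].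
Proof.
move=> an jn ne.
(* These are the two cycle neighbours of [a]; if [up] is not nearer to [j], then [dn] is. *)
pose up := if a.+1 == n then 0 else a.+1.
pose dn := if a == 0 then n.-1 else a.-1.
have upn : up < n by rewrite /up; case: (eqVneq a.+1 n); lia.
have dnn : dn < n by rewrite /dn; case: (eqVneq a 0); lia.
have [E|nE] := eqVneq (cyc a j) (cyc up j).+1.
  by exists up; split=> //; rewrite cadjE // /up; case: (eqVneq a.+1 n); lia.
exists dn; split=> //; first by rewrite cadjE // /dn; case: (eqVneq a 0); lia.
move: nE; rewrite /dn /up /cyc; case: (eqVneq a.+1 n); case: (eqVneq a 0); lia.
Qed.

End CycleDistance.

(** * The distance formula on labels *)

Section SequenceDistance.
Variable n : nat.
Local Notation cyc := (cyc n).
Implicit Types s t x y : seq nat.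

Definition up s := sumn [seq (cyc 0 a).+1 | a <- s].

(* In a recursive call, [::] is the vertex to which the current cycle is attached. *)
Fixpoint sdist s t : nat :=
  match s, t with
  | a :: s', b :: t' => if a == b then sdist s' t' else cyc a b + up s' + up t'
  | [::], _ => up t
  | _, [::] => up s
  end.

Lemma up_cat s t : up (s ++ t) = up s + up t.
Proof. by rewrite /up map_cat sumn_cat. Qed.

Lemma sdist0r s : sdist s [::] = up s. Proof. by case: s. Qed.

Lemma sdistss s : sdist s s = 0.
Proof. by elim: s => //= a s ->; rewrite eqxx. Qed.

Lemma sdistC s t : sdist s t = sdist t s.
Proof.
elim: s t => [|a s IH] [|b t] //=.
by rewrite eq_sym IH cycC; case: eqP => // _; lia.
Qed.

Lemma sdist_cat x s t : sdist (x ++ s) (x ++ t) = sdist s t.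
Proof. by elim: x => //= a x ->; rewrite eqxx. Qed.

Lemma sdist_prefix x t : sdist x (x ++ t) = up t.
Proof. by rewrite -{1}[x]cats0 sdist_cat. Qed.

Lemma sdist_seq1 a b t : sdist [:: a] (b :: t) = cyc a b + up t.
Proof. by rewrite /=; case: eqP => [->|_]; rewrite ?cycii //= addn0. Qed.

Lemma sdist_rcons_cat y a b t : sdist (rcons y a) (y ++ b :: t) = cyc a b + up t.
Proof. by rewrite -cats1 sdist_cat sdist_seq1. Qed.

(** That is, [t] is not strictly below [x] in the branching structure. *)
Definition outside x t := ~~ prefix x t || (t == x).

(** This is the cut-vertex property: a route from below [x] to a vertex not below [x] passes through
    [x]. *)
Lemma sdist_outside x s t : outside x t -> sdist (x ++ s) t = sdist x t + up s.
Proof.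
rewrite /outside; elim: x t => [|a x IH] [|b t] //=; first by rewrite sdist0r.
  by move=> _; rewrite -cat_cons up_cat.
rewrite eqseq_cons [b == a]eq_sym; case: eqP => [_|_ _]; first exact: IH.
by rewrite up_cat; lia.
Qed.

Lemma insideP x t : ~~ outside x t -> exists b t', t = x ++ b :: t'.
Proof.
rewrite negb_or negbK => /andP[/prefixP[[|b t'] ->]]; first by rewrite cats0 eqxx.
by exists b, t'.
Qed.

Lemma outside_size x t : size t <= size x -> outside x t.
Proof.
move=> le; apply/negPn/negP => /insideP[b [t' E]].
by move: le; rewrite E size_cat /=; lia.
Qed.

(** Routes leaving the branch of the cycle go through its head 0; all others go through the position
    [j] above [t]. Either way only one cycle distance changes. *)
Lemma sdist_lip_cycle y a b t : a < n -> b < n -> all (ltn^~ n) t -> cadj n a b ->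
  sdist (rcons y a) t <= (sdist (rcons y b) t).+1.
Proof.
move=> an bn tn ab; have n0 : 0 < n by lia.
have [out|] := boolP (outside y t).
  rewrite -!cats1 !sdist_outside // /up /= !addn0 !(cycC _ 0).
  have := cyc_lip an bn n0 ab; lia.
move=> /insideP[j [t' E]]; move: tn; rewrite E all_cat /= => /and3P[_ jn _].
rewrite !sdist_rcons_cat; have := cyc_lip an bn jn ab; lia.
Qed.

Lemma sdist_lip_child s t :
  sdist s t <= (sdist (rcons s 0) t).+1 /\ sdist (rcons s 0) t <= (sdist s t).+1.
Proof.
have [out|] := boolP (outside s t).
  rewrite -cats1 sdist_outside // /up /= cyc0; lia.
move=> /insideP[b [t' ->]]; rewrite sdist_rcons_cat sdist_prefix /up /=; lia.
Qed.

(** * Valid labels and moves along edges *)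

Variable k : nat.

Definition lcg_label s := [&& 0 < size s, size s <= k, all (ltn^~ n) s & lcg_valid_seq s].

Lemma lcg_valid_rcons y a : lcg_valid_seq (rcons y a) = all (predC1 0) (behead y).
Proof.
rewrite /lcg_valid_seq size_rcons /=; case: y => //= b y.
rewrite (iotaDl 1 0) all_map -[in RHS](mkseq_nth 0 y) /mkseq all_map.
apply: eq_in_all => i; rewrite mem_iota /= => lt.
by rewrite nth_rcons lt.
Qed.

Lemma lcg_label_rcons y a :
  lcg_label (rcons y a) =
  [&& size y < k, all (ltn^~ n) y, a < n & all (predC1 0) (behead y)].
Proof.
rewrite /lcg_label size_rcons all_rcons lcg_valid_rcons /= -andbA.
by congr (_ && _); rewrite andbCA.
Qed.

Lemma lcg_adj_seqP s t : 0 < size s -> 0 < size t ->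
  reflect [\/ exists y a b, [/\ s = rcons y a, t = rcons y b & cadj n a b],
              t = rcons s 0 | s = rcons t 0] (lcg_adj_seq n s t).
Proof.
case/lastP: s => // y a _; case/lastP: t => // z b _; rewrite /lcg_adj_seq.
rewrite !size_rcons /= !last_rcons -!cats1 !take_size_cat // !cats1 -orbA eqSS.
apply: (iffP or3P) => -[].
- by case/and3P=> _ /eqP<- ab; constructor 1; exists y, a, b.
- by move/eqP; constructor 2.
- by move/eqP; constructor 3.
- case=> [y' [a' [b' [/rcons_inj[-> ->] /rcons_inj[-> ->] ab]]]].
  by constructor 1; rewrite !eqxx.
- by move=> ->; constructor 2.
- by move=> ->; constructor 3.
Qed.

Lemma sdist_lip s s' t : lcg_label s -> lcg_label s' -> lcg_label t ->
  lcg_adj_seq n s s' -> sdist s t <= (sdist s' t).+1.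
Proof.
move=> /and4P[s0 _ sn _] /and4P[s'0 _ s'n _] /and4P[_ _ tn _] /(lcg_adj_seqP s0 s'0).
case=> [[y [a [b [E E' ab]]]]|->|->].
- move: sn s'n; rewrite E E' !all_rcons => /andP[an _] /andP[bn _].
  exact: sdist_lip_cycle.
- by case: (sdist_lip_child s t).
- by case: (sdist_lip_child s' t).
Qed.

(** The continuation [b :: t] shows that [s] is above the last layer and is not a head of a layer
    past the first. *)
Lemma lcg_label_child s b t : 0 < size s -> lcg_label (s ++ b :: t) -> lcg_label (rcons s 0).
Proof.
rewrite lastI -rcons_cat => s0; rewrite !lcg_label_rcons size_cat size_belast.
case/and4P=> lt; rewrite all_cat => /andP[-> _] bn.
by case: s s0 lt => //= c s _ lt; rewrite all_cat => /andP[-> _]; rewrite !andbT; apply/andP; lia.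
Qed.

Lemma lcg_label_parent y a : 0 < size y -> lcg_label (rcons y a) -> lcg_label y.
Proof.
case/lastP: y => // y c _; rewrite !lcg_label_rcons size_rcons all_rcons.
case/and4P=> lt /andP[/= -> ->] _ nz; rewrite (ltnW lt) /=.
by case: y nz {lt} => //= e y; rewrite all_rcons => /andP[].
Qed.

Lemma adj_seq_cycle y a b : cadj n a b -> lcg_adj_seq n (rcons y a) (rcons y b).
Proof.
move=> ab; apply/lcg_adj_seqP; rewrite ?size_rcons //.
by constructor 1; exists y, a, b.
Qed.

Lemma adj_seq_child s : 0 < size s -> lcg_adj_seq n s (rcons s 0).
Proof. by move=> s0; apply/lcg_adj_seqP; rewrite ?size_rcons //; constructor 2. Qed.

Lemma adj_seq_parent s : 0 < size s -> lcg_adj_seq n (rcons s 0) s.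
Proof. by move=> s0; apply/lcg_adj_seqP; rewrite ?size_rcons //; constructor 3. Qed.

Lemma lcg_label_swap y a b : b < n -> lcg_label (rcons y a) -> lcg_label (rcons y b).
Proof. by move=> bn; rewrite !lcg_label_rcons bn => /and4P[-> -> _ ->]. Qed.

(** If [t] is below [s], step to the child head; if [t] is elsewhere on or below the same cycle,
    move along it; otherwise approach the head, or step from it to the parent. *)
Lemma sdist_descent s t : lcg_label s -> lcg_label t -> s != t ->
  exists s', [/\ lcg_label s', lcg_adj_seq n s s' & sdist s t = (sdist s' t).+1].
Proof.
move=> ls lt ne; have [s0 _ sn _] := and4P ls; have [t0 _ tn _] := and4P lt.
have [out|/insideP[b [t' E]]] := boolP (outside s t); last first.
  exists (rcons s 0); split; first by apply: (@lcg_label_child _ b t' s0); rewrite -E.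
    exact: adj_seq_child.
  by rewrite E sdist_rcons_cat sdist_prefix /up /=.
case/lastP: s ls ne s0 sn out => // y a ls ne _; rewrite all_rcons => /andP[/= an yn] out.
have [outy|/insideP[b [t' E]]] := boolP (outside y t); last first.
  have bn : b < n by move: tn; rewrite E all_cat /= => /and3P[].
  have ab : a != b.
    apply: contraL out => /eqP ab; rewrite negb_or negbK eq_sym ne andbT.
    by rewrite E ab -cat_rcons prefix_prefix.
  have [c [cn ac Ec]] := cyc_descent an bn ab.
  exists (rcons y c); split; [exact: lcg_label_swap ls|exact: adj_seq_cycle|].
  by rewrite E !sdist_rcons_cat Ec.
have [a0|a0] := eqVneq a 0.
  have y0 : 0 < size y.
    case: (y) outy => //; rewrite /outside prefix0s /=; by case: (t) t0.
  exists y; split; [exact: lcg_label_parent ls|rewrite a0; exact: adj_seq_parent|].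
  by rewrite a0 -cats1 sdist_outside // /up /= cyc0; lia.
have n0 : 0 < n by lia.
have [c [cn ac Ec]] := cyc_descent an n0 a0.
exists (rcons y c); split; [exact: lcg_label_swap ls|exact: adj_seq_cycle|].
by rewrite -!cats1 !sdist_outside // /up /= !addn0 !(cycC _ 0) Ec; lia.
Qed.

Definition end_label s := (size s == k) && (last 0 s != 0).

(** Such a vertex has its own cycle on one side and a parent or a child on the other; step to the
    side away from [t]. *)
Lemma sdist_extend s t : 2 < n -> 1 < k -> lcg_label s -> ~~ end_label s ->
  exists s', [/\ lcg_label s', lcg_adj_seq n s s' & sdist s' t = (sdist s t).+1].
Proof.
move=> n3 k2 ls; rewrite negb_and negbK => ne; have [s0 sk sn _] := and4P ls.
case/lastP: s ls ne s0 sk sn => // y a ls; rewrite size_rcons last_rcons => ne _ yk.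
rewrite all_rcons => /andP[/= an yn].
(* A head past the first layer has a parent; any other vertex considered here has a child. *)
have [/andP[/eqP a0 y0]|hd] := boolP ((a == 0) && (0 < size y)).
  have [outy|/insideP[b [t' ->]]] := boolP (outside y t); last first.
    exists y; split; [exact: lcg_label_parent ls|rewrite a0; exact: adj_seq_parent|].
    by rewrite a0 sdist_rcons_cat sdist_prefix /up /=.
  have c01 : cadj n 0 1 by rewrite cadjE; lia.
  exists (rcons y 1); split; [apply: lcg_label_swap ls; lia|by rewrite a0; exact: adj_seq_cycle|].
  rewrite a0 -!cats1 !sdist_outside // /up /= /cyc; lia.
have [out|/insideP[b [t' ->]]] := boolP (outside (rcons y a) t); last first.
  pose c := if a.+1 == n then 0 else a.+1.
  have cn : c < n by rewrite /c; case: (eqVneq a.+1 n); lia.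
  exists (rcons y c); split; first exact: lcg_label_swap ls.
    by apply: adj_seq_cycle; rewrite cadjE // /c; case: (eqVneq a.+1 n); lia.
  rewrite sdist_prefix cat_rcons sdist_rcons_cat -add1n; congr (_ + _).
  by rewrite /c /cyc; case: (eqVneq a.+1 n); lia.
exists (rcons (rcons y a) 0); split; last first.
- by rewrite -cats1 sdist_outside // /up /= cyc0; lia.
- by apply: adj_seq_child; rewrite size_rcons.
move: ls; rewrite !lcg_label_rcons size_rcons all_rcons /= => /and4P[_ -> -> nz] /=.
case: (y) ne hd yk nz => [|c z] /=; first by rewrite !andbT => *; lia.
rewrite all_rcons /= => ne hd yk ->; rewrite andbT; lia.
Qed.

End SequenceDistance.

(** * Counting chosen positions on one cycle *)

(** The negated term credits one unit to a cycle with a far position missing, so that one bound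
    serves both kinds of cycle. *)
Lemma half_cover_count n (g : nat -> bool) : 2 < n ->
  (forall a b, 0 < a < n -> 0 < b < n -> cyc n a b = n./2 -> g a || g b) ->
  n.+1./2 <= \sum_(a < n) ((0 < a) && g a) + ~~ (g n./2 && g n.+1./2).
Proof.
move=> n3 cov; pose G (a : nat) := nat_of_bool ((0 < a) && g a).
rewrite -(big_mkord xpredT G).
have shift p q m : \sum_(p + m <= j < q + m) G j = \sum_(p <= i < q) G (i + m).
  by rewrite big_addn addnK.
(* Each [i] in [1, p) is at cycle distance [n./2] from [i + m]. *)
have pairs p m : 0 < m -> (m == n./2) || (m == n.+1./2) -> p.-1 + m < n ->
    p.-1 <= \sum_(1 <= i < p) G i + \sum_(1 <= i < p) G (i + m).
  move=> m0 Em pm; rewrite -big_split /= -[p.-1]subn1 -{1}[p - 1]muln1.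
  rewrite -[_ * _]sum_nat_const_nat !big_nat; apply: leq_sum => i ip.
  have := cov i (i + m); rewrite /G /cyc; case: (g i); case: (g (i + m)) => // => h; lia.
have split3 p q : 1 <= p -> p <= q -> q <= n ->
    \sum_(0 <= a < n) G a = \sum_(1 <= a < p) G a + \sum_(p <= a < q) G a + \sum_(q <= a < n) G a.
  move=> p1 pq qn; rewrite big_ltn ?(leq_trans p1) ?(leq_trans pq) // add0n.
  by rewrite (big_cat_nat p1 (leq_trans pq qn)) //= (big_cat_nat pq qn) /= addnA.
(* Both far positions fill the middle block; the shift by [n.+1./2] pairs the positions before it
   with those after it. *)
have [/andP[gh gH]|_] /= := boolP (g _ && g _).
  rewrite addn0 (split3 n./2 n.+1./2.+1); [|lia..].
  have := pairs n./2 n.+1./2; have := shift 1 n./2 n.+1./2.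
  have -> : n./2 + n.+1./2 = n by lia.
  rewrite add1n => -> /(_ _ _ _)-pr.
  have {pr} := pr ltac:(lia) ltac:(lia) ltac:(lia).
  have -> : \sum_(n./2 <= a < n.+1./2.+1) G a = n.+1./2.+1 - n./2.
    rewrite -[RHS]muln1 -sum_nat_const_nat !big_nat; apply: eq_bigr => i ip.
    have [->|->] : i = n./2 \/ i = n.+1./2 by lia.
      by rewrite /G gh; case: ltnP => //; lia.
    by rewrite /G gH; case: ltnP => //; lia.
  lia.
(* The shift by [n./2] now gives [n.+1./2 - 1] pairs, and the credit supplies the missing unit. The
   middle block is empty for odd [n]. *)
rewrite (split3 n.+1./2 n./2.+1); [|lia..].
have := pairs n.+1./2 n./2; have := shift 1 n.+1./2 n./2.
have -> : n.+1./2 + n./2 = n by lia.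
rewrite add1n => -> pr.
have {pr} := pr ltac:(lia) ltac:(lia) ltac:(lia).
lia.
Qed.

(** * Transfer of the distance formula from labels to vertices *)

Section LayerCycleGraph.
Variables n k : nat.
Hypotheses (n3 : 2 < n) (k2 : 1 < k).
Local Notation V := (LCGv n k).
Local Notation e := (@lcg_adj n k).
Implicit Types (u v w : V) (s t x y : seq nat).

Definition label v := lcg_seq (val v).

Lemma ord_seq_ex m s : all (ltn^~ m) s -> exists r : seq 'I_m, map val r = s.
Proof.
elim: s => [|a s IH]; first by exists [::].
by case/andP=> am /IH[r <-]; exists (Ordinal am :: r).
Qed.

Lemma label_ex s : lcg_label n k s -> exists v, label v == s.
Proof.
case/and4P=> s0 sk /ord_seq_ex[r Er] sv.
have pk : (size s).-1 < k by lia.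
have sr : size r == (Ordinal pk).+1 by rewrite /= -(size_map val) Er; lia.
pose v0 : LCGraw n k := Tagged (fun p : 'I_k => (p.+1).-tuple 'I_n) (Tuple sr).
have v0v : lcg_valid_seq (lcg_seq v0) by rewrite /lcg_seq /= Er.
by exists (Sub v0 v0v); rewrite /label SubK /lcg_seq /= Er.
Qed.

Lemma label_inj : injective label.
Proof.
move=> [[p r] pv] [[q t] qv]; rewrite /label /= /lcg_seq /= => E.
apply: val_inj => /=; have Epq : p = q.
  apply: val_inj; move: (congr1 size E); rewrite !size_map !size_tuple; exact: succn_inj.
move: E; case: q / Epq t {qv} => t E.
by congr existT; apply: val_inj; apply: inj_map E; exact: val_inj.
Qed.

Lemma label_ok v : lcg_label n k (label v).
Proof.
rewrite /lcg_label [lcg_valid_seq _](valP v) andbT /label /lcg_seq.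
case: (val v) => p r /=; rewrite size_map size_tuple ltn_ord /=.
by rewrite all_map; apply/allP => i _ /=.
Qed.

Lemma label_descent u v : u != v ->
  exists2 u', e u u' & sdist n (label u) (label v) = (sdist n (label u') (label v)).+1.
Proof.
rewrite -(inj_eq label_inj) => ne.
have [s' [ls us E]] := sdist_descent (label_ok u) (label_ok v) ne.
have [u' /eqP Eu'] := label_ex ls.
by exists u'; rewrite ?Eu' // /lcg_adj -/(label _) -/(label u') Eu'.
Qed.

Lemma dist_label u v : dist e u v = sdist n (label u) (label v).
Proof.
move: u v; apply: dist_characterization => [u|u u' v uu'|]; first exact: sdistss.
  by apply: sdist_lip uu'; exact: label_ok.
exact: label_descent.
Qed.

Lemma dist_lcgC u v : dist e u v = dist e v u.
Proof. by rewrite !dist_label sdistC. Qed.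

Lemma dist_lcg_descent u v : u != v -> exists2 u', e u u' & dist e u v = (dist e u' v).+1.
Proof. by move/label_descent=> [u' uu']; exists u'; rewrite ?dist_label. Qed.

(** * Maximally distant pairs and the cycles of the last layer *)

Lemma not_mmd_extend u v s' : lcg_label n k s' -> lcg_adj_seq n (label v) s' ->
  sdist n (label u) s' = (sdist n (label u) (label v)).+1 -> ~ maximally_distant e u v.
Proof.
move=> ls vs E; have [v' /eqP Ev'] := label_ex ls.
move=> /(_ v'); rewrite !dist_label Ev' E /lcg_adj -/(label _) -/(label v') Ev' vs ltnn.
by move=> /(_ isT).
Qed.

Lemma mmd_end_label u v : maximally_distant e u v -> end_label k (label v).
Proof.
move=> mm; apply/negPn/negP => ne.
have [s' [ls vs E]] := sdist_extend (label u) n3 k2 (label_ok v) ne.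
by apply: not_mmd_extend ls vs _ mm; rewrite sdistC E sdistC.
Qed.

(* The entries of a cycle prefix after the first are non-zero, whence the shift by one. *)
Definition end_cycle : finType := ('I_n * (k - 2).-tuple 'I_n.-1)%type.

Definition cycle_label (c : end_cycle) : seq nat :=
  (c.1 : nat) :: [seq (val i).+1 | i : 'I_n.-1 <- tval c.2].

Lemma card_end_cycle : #|end_cycle| = n * n.-1 ^ (k - 2).
Proof. by rewrite card_prod card_ord card_tuple card_ord. Qed.

Lemma cycle_label_inj : injective cycle_label.
Proof.
move=> [i r] [j t] [/val_inj-> /= E]; congr pair; apply: val_inj.
by apply: inj_map E => a b [] /val_inj.
Qed.

Lemma size_cycle_label c : size (cycle_label c) = k.-1.
Proof. rewrite /= size_map size_tuple; lia. Qed.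

Lemma cycle_label_ok c a : a < n -> lcg_label n k (rcons (cycle_label c) a).
Proof.
move=> an; rewrite lcg_label_rcons size_cycle_label an.
rewrite [_ < k](_ : _ = true); last lia.
rewrite /= ltn_ord /= !all_map; apply/andP; split; last by apply/allP.
by apply/allP => i _ /=; have := ltn_ord i; lia.
Qed.

Lemma end_labelP s : lcg_label n k s -> end_label k s ->
  exists c a, s = rcons (cycle_label c) a /\ 0 < a < n.
Proof.
case/lastP: s => // y a; rewrite lcg_label_rcons /end_label size_rcons last_rcons.
case/and4P=> _ yn an nz /andP[/eqP sy a0].
case: y yn nz sy => [|i y] /=; first lia.
case/andP=> i_n yn nz sy.
have /ord_seq_ex[r Er] : all (ltn^~ n.-1) [seq j.-1 | j <- y].
  rewrite all_map; apply/allP => j jy /=.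
  have := allP yn j jy; have := allP nz j jy => /=; lia.
have sr : size r == k - 2 by rewrite -(size_map val) Er size_map; lia.
exists (Ordinal i_n, Tuple sr), a; split; last lia.
congr (rcons (_ :: _) _); rewrite /= (map_comp succn val) Er -map_comp.
rewrite -[LHS]map_id; apply/eq_in_map => j jy /=.
by have := allP nz j jy => /=; lia.
Qed.

(** A child would lie beyond layer [k], and only a head is adjacent to a parent. *)
Lemma adj_end_label c a s : 0 < a -> lcg_label n k s ->
  lcg_adj_seq n (rcons (cycle_label c) a) s -> exists2 b, b < n & s = rcons (cycle_label c) b.
Proof.
move=> a0 /and4P[s0 sk sn _]; case/lcg_adj_seqP; rewrite ?size_rcons //.
- case=> y [a' [b [/rcons_inj[<- _] E _]]]; exists b => //.
  by move: sn; rewrite E all_rcons => /andP[].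
- by move=> E; move: sk; rewrite E !size_rcons size_cycle_label; lia.
by case/rcons_inj=> _ E; rewrite E in a0.
Qed.

Lemma sdist_same_cycle c a b :
  sdist n (rcons (cycle_label c) a) (rcons (cycle_label c) b) = cyc n a b.
Proof. by rewrite -(cats1 _ b) sdist_rcons_cat addn0. Qed.

(** The attaching vertices [cycle_label c] and [cycle_label c'] have labels of equal length, so
    neither lies below the other and a route passes through both. *)
Lemma sdist_diff_cycle c c' a b : c != c' ->
  sdist n (rcons (cycle_label c) a) (rcons (cycle_label c') b) =
  sdist n (cycle_label c) (cycle_label c') + (cyc n 0 a).+1 + (cyc n 0 b).+1.
Proof.
move=> ne; have out c1 c2 d : c1 != c2 -> outside (cycle_label c1) (rcons (cycle_label c2) d).
  move=> ne12; apply/negPn/negP => /insideP[f [t E]].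
  case/negP: ne12; apply/eqP/cycle_label_inj.
  move: (congr1 (take k.-1) E); rewrite take_size_cat ?size_cycle_label //.
  by rewrite -cats1 take_size_cat ?size_cycle_label.
rewrite -(cats1 _ a) sdist_outside ?out // sdistC -(cats1 _ b).
rewrite sdist_outside ?outside_size ?size_cycle_label //.
by rewrite sdistC /up /= !addn0; lia.
Qed.

Lemma mmd_same_cycle c a b u v : 0 < b -> cyc n a b = n./2 ->
  label u = rcons (cycle_label c) a -> label v = rcons (cycle_label c) b ->
  maximally_distant e u v.
Proof.
move=> b0 Eab Eu Ev v'; rewrite /lcg_adj -/(label v) -/(label v') Ev.
case/(adj_end_label b0 (label_ok v')) => b' bn Ev'.
by rewrite !dist_label Eu Ev Ev' !sdist_same_cycle Eab cyc_le_half.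
Qed.

Lemma mmd_diff_cycle c c' a b u v : c != c' -> 0 < b -> cyc n 0 b = n./2 ->
  label u = rcons (cycle_label c) a -> label v = rcons (cycle_label c') b ->
  maximally_distant e u v.
Proof.
move=> ne b0 Eb Eu Ev v'; rewrite /lcg_adj -/(label v) -/(label v') Ev.
case/(adj_end_label b0 (label_ok v')) => b' bn Ev'.
rewrite !dist_label Eu Ev Ev' !sdist_diff_cycle // Eb.
by have := cyc_le_half n 0 b'; lia.
Qed.

(** Here [b - a] is at most [n./2 - 1], so stepping from [a] to [a.-1] increases the distance. *)
Lemma not_mmd_same_cycle c a b u v :
  label u = rcons (cycle_label c) a -> label v = rcons (cycle_label c) b ->
  n.+1./2 <= a -> a < b -> b < n -> ~ maximally_distant e v u.
Proof.
move=> Eu Ev Ha ab bn; have an : a.-1 < n by lia.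
apply: (not_mmd_extend (cycle_label_ok c an)); rewrite Eu.
  by apply: adj_seq_cycle; rewrite cadjE; lia.
by rewrite Ev !sdist_same_cycle /cyc; lia.
Qed.

(** Past [n.+1./2], the position [b.-1] is farther from the head than [b]. *)
Lemma not_mmd_diff_cycle c c' a b u v : c != c' ->
  label u = rcons (cycle_label c) a -> label v = rcons (cycle_label c') b ->
  n.+1./2 < b -> b < n -> ~ maximally_distant e u v.
Proof.
move=> ne Eu Ev Hb bn; have bn1 : b.-1 < n by lia.
apply: (not_mmd_extend (cycle_label_ok c' bn1)); rewrite Ev.
  by apply: adj_seq_cycle; rewrite cadjE; lia.
by rewrite Eu !sdist_diff_cycle // /cyc; lia.
Qed.

(** * The lower and upper bounds *)

Let n_gt0 : 0 < n. Proof. lia. Qed.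

(** Reduction modulo [n] makes this total in [a]. *)
Definition vtx (c : end_cycle) (a : nat) : V :=
  xchoose (label_ex (cycle_label_ok c (ltn_pmod a n_gt0))).

Lemma label_vtx c a : a < n -> label (vtx c a) = rcons (cycle_label c) a.
Proof. by move=> an; rewrite /vtx (eqP (xchooseP (label_ex _))) modn_small. Qed.

Lemma vtx_inj c c' a b : a < n -> b < n -> vtx c a = vtx c' b -> c = c' /\ a = b.
Proof.
move=> an bn /(congr1 label); rewrite !label_vtx // => /rcons_inj E.
have Ec : cycle_label c = cycle_label c' := congr1 fst E.
by have Ea : a = b := congr1 snd E; split=> //; apply: cycle_label_inj.
Qed.

Lemma strong_resolving_mmd (R : {set V}) u v : strong_resolving_set e R -> u != v ->
  maximally_distant e u v -> maximally_distant e v u -> (u \in R) || (v \in R).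
Proof.
move=> /forallP/(_ u)/forallP/(_ v)/implyP res /res/existsP[w /andP[wR rw]] m1 m2.
by case: (mmd_resolver dist_lcg_descent m1 m2 rw) wR => -> ->; rewrite ?orbT.
Qed.

Lemma sdim_lcg_lower (R : {set V}) : strong_resolving_set e R ->
  n.+1./2 * #|end_cycle| <= #|R|.+1.
Proof.
move=> res; pose g c a := vtx c a \in R; pose far c := g c n./2 && g c n.+1./2.
have cnt c : n.+1./2 <= \sum_(a < n) ((0 < a) && g c a) + ~~ far c.
  apply: half_cover_count => // a b /andP[a0 an] /andP[b0 bn] Eab.
  apply: (strong_resolving_mmd res).
  - apply/eqP=> /(vtx_inj an bn)[_ E]; move: Eab; rewrite E cycii; lia.
  - exact: mmd_same_cycle b0 Eab (label_vtx c an) (label_vtx c bn).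
  - by apply: mmd_same_cycle a0 _ (label_vtx c bn) (label_vtx c an); rewrite cycC.
(* Two cycles each missing a far vertex would leave an MMD pair uncovered. *)
have far1 : \sum_c ~~ far c <= 1.
  rewrite -big_mkcond /= sum1_card; apply/card_le1_eqP => c' c nc' nc.
  apply/eqP/negPn/negP => ne; move: nc nc'; rewrite !unfold_in !negb_and.
  have pair a b : (a == n./2) || (a == n.+1./2) -> (b == n./2) || (b == n.+1./2) ->
      g c a || g c' b.
    move=> ha hb; have an : a < n by lia.
    have bn : b < n by lia.
    apply: (strong_resolving_mmd res).
    - by apply/eqP=> /(vtx_inj an bn)[E _]; rewrite E eqxx in ne.
    - by apply: mmd_diff_cycle ne _ _ (label_vtx c an) (label_vtx c' bn); rewrite /cyc; lia.
    rewrite eq_sym in ne.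
    by apply: mmd_diff_cycle ne _ _ (label_vtx c' bn) (label_vtx c an); rewrite /cyc; lia.
  have := pair n./2 n./2; have := pair n./2 n.+1./2.
  have := pair n.+1./2 n./2; have := pair n.+1./2 n.+1./2.
  rewrite !eqxx !orbT => /(_ isT isT) + /(_ isT isT) + /(_ isT isT) + /(_ isT isT).
  by case: (g c _); case: (g c _); case: (g c' _); case: (g c' _).
have le1 : n.+1./2 * #|end_cycle| <=
    \sum_c (\sum_(a < n) ((0 < a) && g c a) + ~~ far c).
  by rewrite mulnC -sum_nat_const; apply: leq_sum.
apply: leq_trans le1 _; rewrite big_split /= -(addn1 #|R|); apply: leq_add => //.
(* The double sum counts pairs of a cycle and a position, which [vtx] embeds into [R]. *)
rewrite pair_bigA /= -big_mkcond /= sum1_card.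
rewrite -(@card_in_imset _ _ (fun p : end_cycle * 'I_n => vtx p.1 p.2)).
  by apply/subset_leq_card/subsetP => _ /imsetP[p /andP[_ pR] ->].
by move=> [c a] [c' b] _ _ /vtx_inj[]// /= -> /val_inj->.
Qed.

Lemma sdim_lcg_upper : exists R : {set V},
  strong_resolving_set e R /\ #|R| = n.+1./2 * #|end_cycle| - 1.
Proof.
have /card_gt0P[c0 _] : 0 < #|end_cycle|.
  by rewrite card_end_cycle muln_gt0 n_gt0 expn_gt0; lia.
pose H := n.+1./2; have Hn : H < n by rewrite /H; lia.
(* The successor skips the head, so the positions are [1] to [H]. *)
pose f (p : end_cycle * 'I_H) := vtx p.1 p.2.+1.
have f_inj : injective f.
  move=> [c a] [c' b] /vtx_inj[||/= -> [/val_inj->]] //=.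
    by have := ltn_ord a; lia.
  by have := ltn_ord b; lia.
pose R := f @: setT :\ vtx c0 H.
have inR c a : 0 < a <= H -> (c, a) != (c0, H) -> vtx c a \in R.
  move=> /andP[a0 aH] ne; have aH' : a.-1 < H by lia.
  rewrite !inE; apply/andP; split.
    apply: contra ne => /eqP/vtx_inj[||-> ->] //; lia.
  by apply/imsetP; exists (c, Ordinal aH'); rewrite // /f /= prednK.
exists R; split; last first.
  have := cardsD1 (vtx c0 H) (f @: setT); rewrite card_imset // cardsT card_prod card_ord.
  have -> : vtx c0 H \in f @: setT.
    have H0 : H.-1 < H by rewrite /H; lia.
    by apply/imsetP; exists (c0, Ordinal H0); rewrite // /f /= prednK //; lia.
  rewrite -/R mulnC -/H; lia.
apply: (strong_resolving_of_mmd dist_lcgC) => u v ne m1 m2.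
have [c [a [Eu /andP[a0 an]]]] := end_labelP (label_ok u) (mmd_end_label m2).
have [c' [b [Ev /andP[b0 bn]]]] := end_labelP (label_ok v) (mmd_end_label m1).
apply/negPn/negP; rewrite negb_or => /andP[uR vR].
have notinR w d i : label w = rcons (cycle_label d) i -> 0 < i -> i < n -> w \notin R ->
    H < i \/ (d = c0 /\ i = H).
  move=> Ew i0 i_n wR; have [le|] := leqP i H; last by left.
  right; have Ewv : w = vtx d i by apply: label_inj; rewrite label_vtx.
  have [[-> ->]//|neq] := eqVneq (d, i) (c0, H).
  by rewrite Ewv inR ?i0 ?le in wR.
have ua := notinR _ _ _ Eu a0 an uR; have vb := notinR _ _ _ Ev b0 bn vR.
(* On one cycle, both positions missing from [R] are at least [H]. On different cycles, at most one
   vertex is the removed one, so the other lies past [H]. *)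
have [Ec|nec] := eqVneq c c'.
  rewrite -{}Ec {c'} in Ev vb.
  have [lt|lt|E] := ltngtP a b; last by rewrite -E -Eu in Ev; rewrite (label_inj Ev) eqxx in ne.
    apply: not_mmd_same_cycle Eu Ev _ lt bn m2; lia.
  apply: not_mmd_same_cycle Ev Eu _ lt an m1; lia.
have [E|n0] := eqVneq c' c0; last first.
  case: vb => [Hb|[E _]]; last by rewrite E eqxx in n0.
  exact: not_mmd_diff_cycle nec Eu Ev Hb bn m1.
case: ua => [Ha|[E' _]]; last by rewrite E E' eqxx in nec.
by rewrite eq_sym in nec; exact: not_mmd_diff_cycle nec Ev Eu Ha an m2.
Qed.

End LayerCycleGraph.

Theorem theorem5 (n k : nat) (hn : 3 <= n) (hk : 2 <= k) :
  is_sdim (@lcg_adj n k) ((n.+1)./2 * (n * (n.-1) ^ (k - 2)) - 1).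
Proof.
rewrite -card_end_cycle; split; first exact: sdim_lcg_upper.
by move=> R /(sdim_lcg_lower hn hk); lia.
Qed.
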